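(* Let $m$ be a histogram model on a finite partition $\Lambda_m$ of cardinality $D_m+1$. For $\theta>0$ set $$\Omega_m(\theta)=\bigcap_{I\in\Lambda_m}\left\{|P_n(I)-P(I)|\le\theta P(I)\right\}.$$ For any $x,\theta>0$, it holds $$\mathbb{P}\left(\chi_n(m)\mathbf{1}_{\Omega_m(\theta)}\ge\sqrt{\frac{D_m}{n}}+\left(1+\sqrt{2\theta}+\frac{\theta}{6}\right)\sqrt{\frac{2x}{n}}\right)\le\exp(-x).$$ More precisely, for any $x,\theta>0$, it holds with probability at least $1-e^{-x}$, $$\chi_n(m)\mathbf{1}_{\Omega_m(\theta)}<\sqrt{\frac{D_m}{n}}+\sqrt{\frac{2x}{n}}+2\sqrt{\frac{\theta}{n}}\left(\sqrt{x}\wedge\left(\frac{xD_m}{2}\right)^{1/4}\right)+\frac{\theta}{3}\sqrt{\frac{x}{n}}\left(\sqrt{\frac{x}{D_m}}\wedge\frac{1}{\sqrt2}\right).$$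
   Context: $(\mathcal{Z},\mathcal{T})$ is a measurable space, $\mu$ a probability measure on it, and $\xi_1,\dots,\xi_n$ ($n\ge1$) are i.i.d. with law $P$ on $(\mathcal{Z},\mathcal{T})$ admitting a density $f_*$ with respect to $\mu$. $P_n=\frac1n\sum_{i=1}^n\delta_{\xi_i}$ is the empirical measure. We write $a\wedge b=\min(a,b)$. For a finite partition $\Lambda_m$ of $\mathcal{Z}$ into measurable sets $I$ with $\mu(I)>0$ and $|\Lambda_m|=D_m+1$, the histogram model is $m=\{f=\sum_{I\in\Lambda_m}\beta_I\mathbf{1}_I;\ \beta_I\ge0,\ \sum_{I}\beta_I\mu(I)=1\}$, with $f_m=\sum_{I\in\Lambda_m}\frac{P(I)}{\mu(I)}\mathbf{1}_I$ and $\hat f_m=\sum_{I\in\Lambda_m}\frac{P_n(I)}{\mu(I)}\mathbf{1}_I$. The chi-square statistic $\chi_n^2(m)$ is $$\chi_n^2(m)=\int_{\mathcal{Z}}\frac{(\hat f_m-f_m)^2}{f_m}\,d\mu=\sum_{I\in\Lambda_m}\frac{(P_n(I)-P(I))^2}{P(I)},$$ and $\chi_n(m)\ge0$ is its square root (it is understood that $P(I)>0$ for every $I\in\Lambda_m$, so that this is well defined). *)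

(* Defs.v *)
From HB Require Import structures.
From mathcomp Require Import all_boot all_order all_algebra.
From mathcomp Require Import all_classical all_reals all_analysis.

Set Implicit Arguments.
Unset Strict Implicit.
Unset Printing Implicit Defensive.

Import Order.TTheory GRing.Theory Num.Theory.
Import numFieldNormedType.Exports.

Local Open Scope classical_set_scope.
Local Open Scope ring_scope.

Section Histogram.
Context {d : measure_display} {Z : measurableType d} {R : realType}.
Implicit Types (mu : probability Z R) (Q : set Z -> \bar R).

Definition is_density mu (P : probability Z R) (f : Z -> R) : Prop :=
  [/\ measurable_fun setT f,
      forall z, 0 <= f z &
      forall A, measurable A -> P A = (\int[mu]_(z in A) (f z)%:E)%E].

(* The D + 1 cells are enumerated by 'I_D.+1; they are pairwise distinct
   because they are disjoint and of positive measure. *)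
Record histogram_partition mu (D : nat) (La : 'I_D.+1 -> set Z) : Prop :=
  HistogramPartition {
    cell_measurable : forall i, measurable (La i) ;
    cell_gt0 : forall i, (0 < mu (La i))%E ;
    cell_disjoint : trivIset setT La ;
    cell_cover : \bigcup_i La i = setT }.

(* f_m is [hist_density mu La P]; \hat f_m is the same expression with the
   empirical measure in place of P. *)
Definition hist_density mu (D : nat) (La : 'I_D.+1 -> set Z) Q (z : Z) : R :=
  \sum_(i < D.+1) fine (Q (La i)) / fine (mu (La i)) * \1_(La i) z.

Definition chi2_stat mu (D : nat) (La : 'I_D.+1 -> set Z) (P : probability Z R)
    Q : R :=
  \int[mu]_z ((hist_density mu La Q z - hist_density mu La P z) ^+ 2
              / hist_density mu La P z).

Definition chi_stat mu (D : nat) (La : 'I_D.+1 -> set Z) (P : probability Z R)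
    Q : R :=
  Num.sqrt (chi2_stat mu La P Q).

End Histogram.

Section Sample.
Context {d d' : measure_display} {T : measurableType d} {Z : measurableType d'}
  {R : realType} {Pr : probability T R} {n : nat}.
Implicit Types xi : 'I_n -> {RV Pr >-> Z}.

Definition mutually_independent xi : Prop :=
  forall (J : {set 'I_n}) (B : 'I_n -> set Z),
    (forall i, measurable (B i)) ->
    Pr (\bigcap_(i in [set i | i \in J]) (xi i @^-1` B i)) =
    (\prod_(i in J) Pr (xi i @^-1` B i))%E.

Definition iid_with_law xi (P : probability Z R) : Prop :=
  mutually_independent xi /\
  forall i A, measurable A -> distribution Pr (xi i) A = P A.

Definition empirical xi (w : T) (A : set Z) : \bar R :=
  ((n%:R^-1)%:E * \sum_(i < n) \d_(xi i w) A)%E.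

Definition Omega_m xi (P : probability Z R) (D : nat) (La : 'I_D.+1 -> set Z)
    (theta : R) : set T :=
  \bigcap_i [set w | `| fine (empirical xi w (La i)) - fine (P (La i)) |
                     <= theta * fine (P (La i))].

End Sample.

(* sqrt (x / D) /\ 1 / sqrt 2, where x / 0 = +oo for x > 0; the division of
   the library would give x / 0 = 0, hence a smaller minimum. *)
Definition capped_sqrt_ratio {R : realType} (x : R) (D : nat) : R :=
  if D == 0%N then (Num.sqrt 2)^-1
  else Num.min (Num.sqrt (x / D%:R)) (Num.sqrt 2)^-1.

(* Main.v *)
Require Import Defs.
From HB Require Import structures.
From mathcomp Require Import all_boot all_order all_algebra.
From mathcomp Require Import all_classical all_reals all_analysis.
From mathcomp Require Import measurable_realfun ring lra.

Set Implicit Arguments.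
Unset Strict Implicit.
Unset Printing Implicit Defensive.

Import Order.TTheory GRing.Theory Num.Theory.
Import numFieldNormedType.Exports.

Local Open Scope classical_set_scope.
Local Open Scope ring_scope.

(** The statistic depends on the sample only through the cells that contain the
    observations, and these cells are i.i.d.: everything happens on the finite
    product space of the functions from the index set of the sample to the index
    set of the cells, with the product weight ([labels_law], [chi_statE],
    [Omega_mE]).

    There, by duality, [n * chi] is the supremum of the sums over the sample of
    the functions [t] on the cells that are centered and of variance at most 1,
    and the supremum is reached at [t = (P_n - P) / (P * chi)]. On the event
    where the relative deviations are at most [theta] and [chi >= z], this
    maximizer is bounded by [b = theta / z]; hence on this event [n * chi]
    coincides with the supremum [Z] over the class of the centered functions of
    variance at most 1 that are also bounded by [b] (only the finitely many
    maximizers matter, so that the class can be taken finite). Since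
    [Z <= n * chi] everywhere, the mean of [Z] is at most [sqrt (n * D)].

    Bousquet's version of Talagrand's inequality then bounds the probability that
    [Z >= m + sqrt (2 x (n + 2 b m)) + b x / 3], with [m = sqrt (n * D)], by
    [exp (- x)] ([sup_emp_tail] applied in [chi_tail] to the class divided by [b]).
    The sharp threshold of the theorem is a value of [z] for which [n * z] dominates
    this quantity: in the terms that contain [theta / z], one bounds [z] below by
    [sqrt (D / n)] or by [sqrt (2 x / n)], and this gives the two sides of each
    minimum ([sharp_threshold_fixpoint]). The first bound of the theorem follows because
    its threshold is larger ([sharp_threshold_le]).

    Bousquet's inequality is proved by the entropy method: entropy is subadditive
    over the coordinates ([entropy_tensor]); a pointwise inequality for the
    exponential ([bousquet_pointwise]) turns this into a differential inequality
    for the Laplace transform of [Z] ([laplace_differential_ineq]), which is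
    integrated explicitly ([bousquet_gap_le0]). *)

(** * Inequalities for the exponential and its relatives *)

Section Calculus.
Context {R : realType}.
Implicit Types (f g : R -> R) (a b c l x y z : R).

Lemma ln_leB1 x : 0 < x -> ln x <= x - 1.
Proof. by move=> x0; have := expR_ge1Dx (ln x); rewrite lnK//; lra. Qed.

Lemma expR_le_quadratic x : `|x| <= 2^-1 -> expR x <= 1 + x + 2 * x ^+ 2.
Proof.
rewrite ler_norml => /andP[x1 x2].
have x0 : 0 < 1 - x by lra.
rewrite -(ler_pM2r x0); apply: (@le_trans _ _ 1); last by nra.
rewrite -[leRHS](expRxMexpNx_1 x) ler_wpM2l ?expR_ge0//.
exact: expR_ge1Dx.
Qed.

Lemma powR4_sqrt x : 0 <= x -> x `^ 4^-1 = Num.sqrt (Num.sqrt x).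
Proof.
move=> x0; rewrite -!powR12_sqrt ?powR_ge0// -powRrM.
by congr (_ `^ _); field.
Qed.

Lemma sqrtD_le a b : 0 <= a -> 0 <= b ->
  Num.sqrt (a + b) <= Num.sqrt a + Num.sqrt b.
Proof.
move=> a0 b0; rewrite -[leRHS]ger0_norm ?addr_ge0 ?sqrtr_ge0//.
rewrite -sqrtr_sqr ler_wsqrtr// sqrrD !sqr_sqrtr//.
by rewrite addrAC lerDl mulrn_wge0// mulr_ge0 ?sqrtr_ge0.
Qed.

Lemma is_derive_sumr (T : Type) (s : seq T) (h : T -> R -> R)
    (dh : T -> R) x :
  (forall t, is_derive x 1 (h t) (dh t)) ->
  is_derive x 1 (fun y => \sum_(t <- s) h t y) (\sum_(t <- s) dh t).
Proof.
move=> hdh; elim: s => [|t s IHs].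
  rewrite big_nil (_ : (fun y => _) = cst 0); first exact: is_derive_cst.
  by apply/funext => y; rewrite big_nil.
rewrite big_cons (_ : (fun y => _) = h t + (fun y => \sum_(t <- s) h t y)).
  exact: is_deriveD.
by apply/funext => y; rewrite big_cons.
Qed.

Lemma ler_of_derive_ge0 f df x y : x <= y ->
  (forall z, x <= z <= y -> is_derive z 1 f (df z)) ->
  (forall z, x <= z <= y -> 0 <= df z) -> f x <= f y.
Proof.
move=> xy hf hd.
have [z zxy e] : exists2 z, z \in `[x, y] & f y - f x = df z * (y - x).
  apply: MVT_segment => //.
    by move=> z; rewrite in_itv /= => /andP[? ?]; apply: hf; rewrite !ltW.
  apply: derivable_within_continuous => z; rewrite in_itv /= => hz.
  by have [] := hf z hz.
rewrite -subr_ge0 e mulr_ge0 ?subr_ge0// hd//.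
Qed.

Lemma ger_of_derive_le0 f df x y : x <= y ->
  (forall z, x <= z <= y -> is_derive z 1 f (df z)) ->
  (forall z, x <= z <= y -> df z <= 0) -> f y <= f x.
Proof.
move=> xy hf hd; rewrite -lerN2.
apply: (@ler_of_derive_ge0 (fun z => - f z) (fun z => - df z)) => // z hz.
  by have ? := hf z hz; exact: is_deriveN.
by rewrite oppr_ge0; exact: hd.
Qed.

(** The inequality that turns a Poissonian Laplace bound into a Bernstein one: the
    difference of the two sides and its first derivative vanish at [0], and its
    second derivative is proportional to [1 + (l - 1) * expR l >= 0]. *)
Lemma bernstein_poly l : 0 <= l ->
  (expR l - 1 - l) * (2 - 2 * l / 3) <= l ^+ 2.
Proof.
move=> l0; rewrite -subr_ge0.
pose q z : R := z * z - (expR z - 1 - z) * (2 - 2 * z / 3).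
pose q1 z : R := 2 * z - (expR z - 1) * (2 - 2 * z / 3)
                 + (expR z - 1 - z) * (2 / 3).
pose q2 z : R := 2 / 3 * (1 + (z - 1) * expR z).
have dq (z : R) : is_derive z 1 q (q1 z).
  by rewrite /q; apply: is_derive_eq; rewrite /GRing.scale/= /q1; field.
have dq1 (z : R) : is_derive z 1 q1 (q2 z).
  by rewrite /q1; apply: is_derive_eq; rewrite /GRing.scale/= /q2; field.
have q20 z : 0 <= z -> 0 <= q2 z.
  move=> z0; rewrite /q2 mulr_ge0//.
  have : 0 <= expR z * (expR (- z) - (1 - z)).
    by rewrite mulr_ge0 ?expR_ge0// subr_ge0 expR_ge1Dx.
  by rewrite mulrBr expRxMexpNx_1; lra.
have q10 z : 0 <= z -> 0 <= q1 z.
  move=> z0; have -> : 0 = q1 0 by rewrite /q1 expR0; lra.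
  by apply: (ler_of_derive_ge0 z0 (fun y _ => dq1 y)) => y /andP[/q20].
have : q 0 <= q l.
  by apply: (ler_of_derive_ge0 l0 (fun y _ => dq y)) => y /andP[/q10].
by rewrite /q expR0 expr2; lra.
Qed.

(** The value at [0] of the derivative [K1] in [bousquet_pointwise] has the sign of
    this expression, all of whose derivatives up to order 2 vanish at [0] while
    the third one is visibly nonnegative. *)
Lemma bousquet_slope_ge0 l : 0 <= l ->
  0 <= 4 * l + 2 + l * l + (2 * (l * l) - 2 * l - 2) * expR l.
Proof.
move=> l0.
pose q z : R := 4 * z + 2 + z * z + (2 * (z * z) - 2 * z - 2) * expR z.
pose q1 z : R := 4 + 2 * z + (2 * (z * z) + 2 * z - 4) * expR z.
pose q2 z : R := 2 + (2 * (z * z) + 6 * z - 2) * expR z.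
pose q3 z : R := (2 * (z * z) + 10 * z + 4) * expR z.
have dq (z : R) : is_derive z 1 q (q1 z).
  by rewrite /q; apply: is_derive_eq; rewrite /GRing.scale/= /q1; ring.
have dq1 (z : R) : is_derive z 1 q1 (q2 z).
  by rewrite /q1; apply: is_derive_eq; rewrite /GRing.scale/= /q2; ring.
have dq2 (z : R) : is_derive z 1 q2 (q3 z).
  by rewrite /q2; apply: is_derive_eq; rewrite /GRing.scale/= /q3; ring.
have q30 z : 0 <= z -> 0 <= q3 z.
  by move=> z0; rewrite mulr_ge0 ?expR_ge0//; nra.
have q20 z : 0 <= z -> 0 <= q2 z.
  move=> z0; have -> : 0 = q2 0 by rewrite /q2 expR0; lra.
  by apply: (ler_of_derive_ge0 z0 (fun y _ => dq2 y)) => y /andP[/q30].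
have q10 z : 0 <= z -> 0 <= q1 z.
  move=> z0; have -> : 0 = q1 0 by rewrite /q1 expR0; lra.
  by apply: (ler_of_derive_ge0 z0 (fun y _ => dq1 y)) => y /andP[/q20].
have : q 0 <= q l.
  by apply: (ler_of_derive_ge0 l0 (fun y _ => dq y)) => y /andP[/q10].
by rewrite /q expR0; lra.
Qed.

(** The constant for which [bousquet_pointwise] is an equality at [x = 1]. *)
Definition bousquet_factor l : R :=
  (2 + 2 * (l - 1) * expR l) / (2 * expR l - 1).

Lemma bousquet_factor_ge0 l : 0 <= l -> 0 <= bousquet_factor l.
Proof.
move=> l0; rewrite /bousquet_factor divr_ge0//.
  have : 0 <= expR l * (expR (- l) - (1 - l)).
    by rewrite mulr_ge0 ?expR_ge0// subr_ge0 expR_ge1Dx.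
  by rewrite mulrBr expRxMexpNx_1; lra.
by have := expR_ge1Dx l; lra.
Qed.

(** Bousquet's pointwise inequality. The difference [G] of the two sides vanishes at
    [0] and at [1], and [G' = expR (l * x) * K x], where [K 0 = 0] and the
    derivative of [K] is nonincreasing on [x <= 1] and nonnegative at [0]. So
    [K <= 0] on the left of [0], and on [[0, 1]] it is first nonnegative and then
    nonpositive: [G] decreases to [0] on the negative half-line, then increases
    from [0] and finally decreases to [0]. *)
Lemma bousquet_pointwise l x : 0 < l -> x <= 1 ->
  1 - expR (l * x) + l * x * expR (l * x) <=
  bousquet_factor l * (x * expR (l * x) - x + x ^+ 2 / 2).
Proof.
move=> l0 x1; set t := bousquet_factor l.
have tE : t * (2 * expR l - 1) = 2 + 2 * (l - 1) * expR l.
  rewrite /t/bousquet_factor divfK//.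
  by apply/eqP; have := expR_ge1Dx l; lra.
have t0 : 0 <= t by apply: bousquet_factor_ge0; exact: ltW.
pose G z : R := t * (z * expR (l * z) - z + z * z / 2)
  - (1 - expR (l * z) + l * z * expR (l * z)).
pose K z : R := t * (1 + l * z - expR (- (l * z)) + z * expR (- (l * z)))
  - l * l * z.
pose K1 z : R := t * (l + l * expR (- (l * z)) + expR (- (l * z))
  - l * z * expR (- (l * z))) - l * l.
pose K2 z : R := t * (l * expR (- (l * z)) * (l * z - l - 2)).
have dG (z : R) : is_derive z 1 G (expR (l * z) * K z).
  rewrite /G; apply: is_derive_eq; rewrite /GRing.scale/= /K.
  have := expRxMexpNx_1 (l * z); move: (expR (- _)) => E' EE'.
  transitivity (t * ((1 + l * z) * expR (l * z) + (z - 1) * (expR (l * z) * E'))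
    - l * l * z * expR (l * z)); last by ring.
  by rewrite EE'; field.
have dK (z : R) : is_derive z 1 K (K1 z).
  by rewrite /K; apply: is_derive_eq; rewrite /GRing.scale/= /K1; ring.
have dK1 (z : R) : is_derive z 1 K1 (K2 z).
  by rewrite /K1; apply: is_derive_eq; rewrite /GRing.scale/= /K2; ring.
have K1ni y z : y <= z -> z <= 1 -> K1 z <= K1 y.
  move=> yz z1; apply: (ger_of_derive_le0 yz (fun y _ => dK1 y)) => u /andP[_ uz].
  have u1 := le_trans uz z1.
  rewrite /K2 mulr_ge0_le0// mulr_ge0_le0//; last by nra.
  by rewrite mulr_ge0 ?expR_ge0// ltW.
have K0 : K 0 = 0 by rewrite /K !mulr0 oppr0 expR0; ring.
have K10 : 0 <= K1 0.
  rewrite /K1 !mulr0 oppr0 expR0.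
  have e0 : 0 < 2 * expR l - 1 by have := expR_ge1Dx l; lra.
  rewrite -(pmulr_lge0 _ e0) mulrBl.
  rewrite (_ : t * _ * _ = (t * (2 * expR l - 1)) * (2 * l + 1)); last by ring.
  rewrite tE; have := bousquet_slope_ge0 (ltW l0); lra.
have G0 : G 0 = 0 by rewrite /G !mulr0 expR0; ring.
have G1 : G 1 = 0.
  rewrite /G !mulr1 mul1r.
  transitivity ((t * (2 * expR l - 1) - (2 + 2 * (l - 1) * expR l)) / 2).
    by field.
  by rewrite tE subrr mul0r.
suff : 0 <= G x by rewrite /G subr_ge0 expr2.
have [x0|x0] := leP x 0.
  rewrite -G0; apply: (ger_of_derive_le0 x0 (fun y _ => dG y)) => y /andP[_ y0].
  rewrite mulr_ge0_le0 ?expR_ge0// -K0.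
  apply: (ler_of_derive_ge0 y0 (fun y _ => dK y)) => u /andP[_ u0].
  by apply: (le_trans K10); exact: K1ni.
(* Once negative on [0, 1], K stays negative, its derivative being monotone. *)
have Kneg y z : 0 <= y -> y <= z -> z <= 1 -> K y < 0 -> K z < 0.
  move=> y0 yz z1 Ky; apply: (le_lt_trans _ Ky).
  apply: (ger_of_derive_le0 yz (fun y _ => dK y)) => u /andP[yu uz].
  rewrite leNgt; apply/negP => K1u; suff : 0 <= K y by rewrite leNgt Ky.
  rewrite -K0; apply: (ler_of_derive_ge0 y0 (fun y _ => dK y)) => v /andP[_ vy].
  apply: (le_trans (ltW K1u)); apply: K1ni; first exact: le_trans yu.
  exact: le_trans z1.
have [Kx|Kx] := ltP (K x) 0.
  rewrite -G1; apply: (ger_of_derive_le0 x1 (fun y _ => dG y)) => y /andP[xy y1].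
  by rewrite mulr_ge0_le0 ?expR_ge0//; apply/ltW/(Kneg x) => //; exact: ltW.
rewrite -G0; apply: (ler_of_derive_ge0 (ltW x0) (fun y _ => dG y)) => y /andP[y0 yx].
rewrite mulr_ge0 ?expR_ge0// leNgt; apply/negP => Ky.
by have := Kneg _ _ y0 yx x1 Ky; rewrite ltNge Kx.
Qed.

End Calculus.

(** * Expectation on a finite product space and subadditivity of entropy *)

Section ProductSpace.
Context {R : realType} {I J : finType} (p : J -> R).
Context (p_ge0 : forall j, 0 <= p j) (p_sum1 : \sum_j p j = 1).
Implicit Types (w : {ffun I -> J}) (g h Y : {ffun I -> J} -> R) (i k : I).

Definition weight w : R := \prod_i p (w i).

Definition mean g : R := \sum_w weight w * g w.

Definition upd w k (j : J) : {ffun I -> J} :=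
  [ffun i => if i == k then j else w i].

(** The conditional expectation given all the coordinates but [k]. *)
Definition avg k g w : R := \sum_j p j * g (upd w k j).

Definition indep_of k g : Prop := forall w j, g (upd w k j) = g w.

Lemma weight_ge0 w : 0 <= weight w.
Proof. exact: prodr_ge0. Qed.

Lemma sum_weight : \sum_w weight w = 1.
Proof.
rewrite -(bigA_distr_bigA (fun (_ : I) j => p j)).
by rewrite big1.
Qed.

Lemma eq_mean g h : g =1 h -> mean g = mean h.
Proof. by move=> gh; apply: eq_bigr => w _; rewrite gh. Qed.

Lemma meanD g h : mean (fun w => g w + h w) = mean g + mean h.
Proof. by rewrite -big_split; apply: eq_bigr => w _; rewrite mulrDr. Qed.

Lemma meanZ c g : mean (fun w => c * g w) = c * mean g.
Proof. by rewrite /mean mulr_sumr; apply: eq_bigr => w _; rewrite mulrCA. Qed.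

Lemma meanB g h : mean (fun w => g w - h w) = mean g - mean h.
Proof.
rewrite -[X in _ = _ + X]mulN1r -meanZ -meanD.
by apply: eq_mean => w; rewrite mulN1r.
Qed.

Lemma mean_cst c : mean (fun=> c) = c.
Proof. by rewrite /mean -mulr_suml sum_weight mul1r. Qed.

Lemma mean_sum (T : Type) (s : seq T) (g : T -> {ffun I -> J} -> R) :
  mean (fun w => \sum_(t <- s) g t w) = \sum_(t <- s) mean (g t).
Proof.
by rewrite exchange_big; apply: eq_bigr => w _; rewrite mulr_sumr.
Qed.

Lemma ler_mean g h : (forall w, g w <= h w) -> mean g <= mean h.
Proof.
by move=> gh; apply: ler_sum => w _; rewrite ler_wpM2l ?weight_ge0.
Qed.

Lemma mean_gt0 g : (forall w, 0 < g w) -> 0 < mean g.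
Proof.
move=> g0; rewrite lt_neqAle eq_sym; apply/andP; split; last first.
  by rewrite -(mean_cst 0); apply: ler_mean => w; exact: ltW.
apply/eqP => /psumr_eq0P m0.
suff : \sum_w weight w = 0 by rewrite sum_weight => /eqP; rewrite oner_eq0.
rewrite big1// => w _; have := m0 (fun w _ => mulr_ge0 (weight_ge0 w) (ltW (g0 w))).
move=> /(_ w isT) /eqP; rewrite mulf_eq0 => /orP[/eqP//|].
by rewrite gt_eqF.
Qed.

(** The tower property. Exchanging the resampled value [j] with the former [k]-th
    coordinate of [w] is an involution that preserves the joint weight of [w] and
    [j]. *)
Lemma mean_avg k g : mean (avg k g) = mean g.
Proof.
pose swap (u : {ffun I -> J} * J) := (upd u.1 k u.2, u.1 k).
have swapK : involutive swap.
  move=> [w j]; rewrite /swap /= ffunE eqxx; congr (_, _).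
  by apply/ffunP => i; rewrite !ffunE; case: eqP => // ->.
rewrite /mean /avg.
under eq_bigr do rewrite mulr_sumr.
rewrite pair_big /= (reindex_inj (inv_inj swapK)) /=.
rewrite -(pair_big xpredT xpredT (fun w j => weight (upd w k j) *
  (p (w k) * g (upd (upd w k j) k (w k))))) /=.
apply: eq_bigr => w _.
transitivity (\sum_j p j * (weight w * g w)); last first.
  by rewrite -mulr_suml p_sum1 mul1r.
apply: eq_bigr => j _.
have -> : upd (upd w k j) k (w k) = w.
  by apply/ffunP => i; rewrite !ffunE; case: eqP => // ->.
rewrite !mulrA; congr (_ * _).
rewrite /weight (bigD1 k)//= [in RHS](bigD1 k)//= ffunE eqxx.
rewrite -!mulrA; congr (_ * _); rewrite [RHS]mulrC; congr (_ * _).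
by apply: eq_bigr => i /negPf ik; rewrite ffunE ik.
Qed.

Lemma mean_coord i (g : J -> R) : mean (fun w => g (w i)) = \sum_j p j * g j.
Proof.
rewrite -(mean_avg i) -[RHS]mean_cst.
by apply: eq_mean => w; apply: eq_bigr => j _; rewrite ffunE eqxx.
Qed.

Lemma upd_upd w k j j' : upd (upd w k j) k j' = upd w k j'.
Proof. by apply/ffunP => i; rewrite !ffunE; case: eqP. Qed.

Lemma upd_comm w i k j j' : i != k ->
  upd (upd w i j) k j' = upd (upd w k j') i j.
Proof.
move=> ik; apply/ffunP => l; rewrite !ffunE.
by case: eqP => [->|//]; rewrite eq_sym (negPf ik).
Qed.

Lemma avg_indep k g : indep_of k (avg k g).
Proof. by move=> w j; apply: eq_bigr => j' _; rewrite upd_upd. Qed.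

Lemma indep_avg i k g : indep_of i g -> indep_of i (avg k g).
Proof.
move=> gi; have [->|ik] := eqVneq i k; first exact: avg_indep.
by move=> w j; apply: eq_bigr => j' _; rewrite upd_comm// gi.
Qed.

Lemma avgMl k h g w : indep_of k h ->
  avg k (fun w => h w * g w) w = h w * avg k g w.
Proof.
by move=> hk; rewrite mulr_sumr; apply: eq_bigr => j _; rewrite hk mulrCA.
Qed.

Lemma avg_gt0 k g : (forall w, 0 < g w) -> forall w, 0 < avg k g w.
Proof.
move=> g0 w; rewrite lt_neqAle eq_sym; apply/andP; split; last first.
  by apply: sumr_ge0 => j _; rewrite mulr_ge0// ltW.
apply/eqP => /psumr_eq0P m0; suff : \sum_j p j = 0.
  by rewrite p_sum1 => /eqP; rewrite oner_eq0.
rewrite big1// => j _.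
have := m0 (fun j _ => mulr_ge0 (p_ge0 j) (ltW (g0 (upd w k j)))).
move=> /(_ j isT) /eqP; rewrite mulf_eq0 => /orP[/eqP//|].
by rewrite gt_eqF.
Qed.

(** One passes from [w] to [w'] by changing the coordinates one after the other. *)
Lemma indep_of_all_cst g : (forall k, indep_of k g) -> forall w w', g w = g w'.
Proof.
move=> gi w w'.
pose mix (s : seq I) : {ffun I -> J} := [ffun i => if i \in s then w' i else w i].
have gmix s : g (mix s) = g w.
  elim: s => [|k s <-]; first by congr g; apply/ffunP => i; rewrite ffunE.
  rewrite -(gi k (mix s) (w' k)); congr g.
  by apply/ffunP => i; rewrite !ffunE inE; case: eqP => [->|].
rewrite -(gmix (enum I)); congr g.
by apply/ffunP => i; rewrite ffunE mem_enum.
Qed.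

Definition avgs (s : seq I) g := foldr avg g s.

Lemma avgs_gt0 s g : (forall w, 0 < g w) -> forall w, 0 < avgs s g w.
Proof. by move=> g0; elim: s => //= k s IHs; exact: avg_gt0. Qed.

Lemma mean_avgs s g : mean (avgs s g) = mean g.
Proof. by elim: s => //= k s IHs; rewrite mean_avg. Qed.

Lemma avgs_enum g w : avgs (enum I) g w = mean g.
Proof.
rewrite -(mean_avgs (enum I)) -[LHS]mean_cst; apply: eq_mean => w'.
apply: indep_of_all_cst => k.
have : k \in enum I by rewrite mem_enum.
elim: (enum I) => //= i s IHs; rewrite inE => /orP[/eqP ->|/IHs].
  exact: avg_indep.
exact: indep_avg.
Qed.

(** When the coordinate [k] is averaged out, the entropy grows by the mean of
    [Y * ln (A / B)], where [A] is the function averaged so far and [B] its average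
    over [k]. By [ln r <= r - 1], [Y * ln (A / B * U / Y) <= U * A / B - Y], and the
    mean of [U * A / B] is that of [U], since [U] and [B] do not depend on the
    coordinate [k]. *)
Lemma entropy_avgs Y (U : I -> {ffun I -> J} -> R) (s : seq I) :
  (forall w, 0 < Y w) -> (forall k w, 0 < U k w) ->
  (forall k, indep_of k (U k)) ->
  mean (fun w => Y w * ln (Y w / avgs s Y w)) <=
  \sum_(k <- s) mean (fun w => Y w * ln (Y w / U k w) - Y w + U k w).
Proof.
move=> Y0 U0 Ui; elim: s => [|k s IHs].
  rewrite big_nil -(mean_cst 0); apply: ler_mean => w /=.
  by rewrite divff ?gt_eqF// ln1 mulr0.
rewrite big_cons /= addrC; set A := avgs s Y in IHs *; set B := avg k A.
have A0 w : 0 < A w by exact: avgs_gt0.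
have B0 w : 0 < B w by exact: avg_gt0.
apply: le_trans (lerD IHs (lexx _)).
have UE : mean (fun w => U k w / B w * A w) = mean (U k).
  rewrite -(mean_avg k); apply: eq_mean => w.
  rewrite (@avgMl _ (fun w => U k w / B w)).
    by rewrite mulfVK// gt_eqF.
  by move=> w' j; rewrite Ui /B avg_indep.
rewrite [X in _ <= _ + X]meanD -UE -!meanD; apply: ler_mean => w.
have [Yw Uw Aw Bw] := And4 (Y0 w) (U0 k w) (A0 w) (B0 w).
have : Y w * ln (U k w / B w * A w / Y w) <= U k w / B w * A w - Y w.
  rewrite (_ : _ - Y w = Y w * (U k w / B w * A w / Y w - 1)).
    by rewrite ler_pM2l// ln_leB1// divr_gt0// mulr_gt0// divr_gt0.
  by rewrite mulrBr mulr1 [Y w * _]mulrC mulfVK// gt_eqF.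
rewrite !(ln_div, lnM) ?posrE ?(divr_gt0, mulr_gt0)//.
by lra.
Qed.

(** Subadditivity of entropy over independent coordinates, in variational form:
    since the functions [U k] are free, the entropy along the coordinate [k] can be
    estimated by comparing [Y] with any function deprived of this coordinate. *)
Lemma entropy_tensor Y (U : I -> {ffun I -> J} -> R) :
  (forall w, 0 < Y w) -> (forall k w, 0 < U k w) ->
  (forall k, indep_of k (U k)) ->
  mean (fun w => Y w * ln (Y w / mean Y)) <=
  \sum_k mean (fun w => Y w * ln (Y w / U k w) - Y w + U k w).
Proof.
move=> Y0 U0 Ui; rewrite -big_enum /=; have := entropy_avgs (enum I) Y0 U0 Ui.
by under eq_mean => w do rewrite avgs_enum.
Qed.

End ProductSpace.

(** * Entropy bound for the supremum of a finite empirical process *)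

Section FiniteMax.
Context {R : realType} {K : finType} (k0 : K).
Implicit Types g h : K -> R.

Definition fmax g : R := g [arg max_(k > k0) g k]%O.

Lemma fmax_ge g k : g k <= fmax g.
Proof. by rewrite /fmax; case: arg_maxP => // k' _; exact. Qed.

Lemma fmax_attained g : exists k, fmax g = g k.
Proof. by eexists. Qed.

Lemma eq_fmax g h : g =1 h -> fmax g = fmax h.
Proof. by move=> /funext ->. Qed.

End FiniteMax.

Section SupEmpirical.
Context {R : realType} {I J K : finType} (p : J -> R) (k0 : K) (f : K -> J -> R).
Context (s2 : R).
Context (p_ge0 : forall j, 0 <= p j) (p_sum1 : \sum_j p j = 1).
Context (f_le1 : forall k j, f k j <= 1).
Context (f_mean0 : forall k, \sum_j p j * f k j = 0).
Context (f_var : forall k, \sum_j p j * f k j ^+ 2 <= s2).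
Implicit Types (w : {ffun I -> J}) (i : I) (l x : R).

Local Notation mean := (@mean R I J p).

Definition sup_emp w : R := fmax k0 (fun k => \sum_i f k (w i)).

Definition sup_emp_but i w : R :=
  fmax k0 (fun k => \sum_(i' | i' != i) f k (w i')).

Lemma sup_emp_but_indep i : indep_of i (sup_emp_but i).
Proof.
move=> w j; apply: eq_fmax => k; apply: eq_bigr => i' /negPf ii'.
by rewrite ffunE ii'.
Qed.

(** The maximizer of the sums without the term [i] does not depend on the
    coordinate [i]: it bounds the increments below by a function of the resampled
    value alone, and this function is centered. *)
Lemma sup_emp_upd_ge i w :
  exists k, forall j, sup_emp_but i w + f k j <= sup_emp (upd w i j).
Proof.
have [k kE] := fmax_attained k0 (fun k => \sum_(i' | i' != i) f k (w i')).
exists k => j; rewrite /sup_emp_but kE addrC.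
apply: le_trans (fmax_ge k0 _ k); rewrite [leRHS](bigD1 i)//= ffunE eqxx lerD2l.
by apply: ler_sum => i' /negPf ii'; rewrite ffunE ii'.
Qed.

(** Dually, the maximizer of the full sums bounds all the increments above. *)
Lemma sup_emp_increment w :
  exists k, sup_emp w = \sum_i f k (w i) /\
    forall i, sup_emp w - sup_emp_but i w <= f k (w i).
Proof.
have [k kE] := fmax_attained k0 (fun k => \sum_i f k (w i)).
exists k; split=> // i; rewrite /sup_emp kE (bigD1 i)//= lerBlDr lerD2l.
exact: (fmax_ge k0 (fun k => \sum_(i' | i' != i) f k (w i'))).
Qed.

Lemma sup_emp_increment_le1 i w : sup_emp w - sup_emp_but i w <= 1.
Proof. by have [k [_ /(_ i) /le_trans]] := sup_emp_increment w; exact. Qed.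

Lemma sum_sup_emp_increment w :
  \sum_i (sup_emp w - sup_emp_but i w) <= sup_emp w.
Proof.
by have [k [kE kle]] := sup_emp_increment w; rewrite {2}kE; exact: ler_sum.
Qed.

Lemma mean_sup_emp_ge0 : 0 <= mean sup_emp.
Proof.
apply: (@le_trans _ _ (mean (fun w => \sum_i f k0 (w i)))); last first.
  by apply: ler_mean => // w; exact: (fmax_ge k0 (fun k => \sum_i f k (w i))).
by rewrite mean_sum big1// => i _; rewrite mean_coord.
Qed.

Definition laplace l : R := mean (fun w => expR (l * sup_emp w)).

Definition laplace' l : R := mean (fun w => sup_emp w * expR (l * sup_emp w)).

Lemma laplace_gt0 l : 0 < laplace l.
Proof. by apply: mean_gt0 => // w; exact: expR_gt0. Qed.

(** Jensen's inequality along the coordinate [i], in the form [1 + u <= expR u]: the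
    increment is at least a centered function of this coordinate. *)
Lemma mean_sup_emp_but_le i l : 0 <= l ->
  mean (fun w => expR (l * sup_emp_but i w)) <= laplace l.
Proof.
move=> l0; rewrite /laplace -[leRHS](mean_avg p_sum1 i).
apply: ler_mean => // w; have [k hk] := sup_emp_upd_ge i w.
set u := expR _.
have <- : \sum_j p j * (u * (1 + l * f k j)) = u.
  under eq_bigr do rewrite mulrCA mulrDr mulr1 (mulrCA _ l).
  by rewrite -mulr_sumr big_split/= p_sum1 -mulr_sumr f_mean0 mulr0 addr0 mulr1.
apply: ler_sum => j _; apply: ler_wpM2l => //.
apply: le_trans (_ : u * expR (l * f k j) <= _).
  by rewrite ler_wpM2l ?expR_ge0 ?expR_ge1Dx.
by rewrite -expRD ler_expR -mulrDr ler_wpM2l.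
Qed.

(** The map [y |-> y ^+ 2 / 2 - y] is nonincreasing on [y <= 1], so the increment may
    be replaced by its lower bound [f k j], whose mean is zero and whose second
    moment is at most [s2]. *)
Lemma mean_increment_le i l : 0 <= l -> 0 <= s2 ->
  mean (fun w => expR (l * sup_emp_but i w) *
    ((sup_emp w - sup_emp_but i w) ^+ 2 / 2 - (sup_emp w - sup_emp_but i w)))
  <= s2 / 2 * laplace l.
Proof.
move=> l0 s20; rewrite -(mean_avg p_sum1 i).
apply: (@le_trans _ _ (s2 / 2 * mean (fun w => expR (l * sup_emp_but i w)))).
  rewrite -meanZ; apply: ler_mean => // w; rewrite avgMl; last first.
    by move=> w' j; rewrite sup_emp_but_indep.
  rewrite mulrC ler_wpM2r ?expR_ge0//.
  have [k hk] := sup_emp_upd_ge i w.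
  apply: (@le_trans _ _ (\sum_j p j * (f k j ^+ 2 / 2 - f k j))); last first.
    under eq_bigr do rewrite mulrBr mulrA.
    by rewrite sumrB f_mean0 subr0 -mulr_suml ler_pM2r.
  apply: ler_sum => j _; apply: ler_wpM2l => //.
  have := sup_emp_increment_le1 i (upd w i j); rewrite sup_emp_but_indep.
  by move: (hk j) (f_le1 k j); nra.
by rewrite ler_wpM2l ?divr_ge0// mean_sup_emp_but_le.
Qed.

(** Subadditivity of entropy is applied with [U i] the exponential of the supremum
    without the [i]-th term. By [bousquet_pointwise], the [i]-th summand is at most
    the sum of two parts. One is proportional to the [i]-th increment of the
    supremum, and these increments add up to at most the supremum. The other is
    bounded by [mean_increment_le]. *)
Lemma laplace_differential_ineq l : 0 < l -> 0 <= s2 ->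
  l * laplace' l - laplace l * ln (laplace l) <=
  bousquet_factor l * (laplace' l + #|I|%:R * s2 / 2 * laplace l).
Proof.
move=> l0 s20; set t := bousquet_factor l.
have t0 : 0 <= t by exact/bousquet_factor_ge0/ltW.
pose Y w := expR (l * sup_emp w); pose U i w := expR (l * sup_emp_but i w).
have Ui i : indep_of i (U i) by move=> w j; rewrite /U sup_emp_but_indep.
have := entropy_tensor p_ge0 p_sum1 (fun w => expR_gt0 (l * sup_emp w))
  (fun i w => expR_gt0 (l * sup_emp_but i w)) Ui.
rewrite -/(laplace l); have F0 := laplace_gt0 l.
have -> : mean (fun w => expR (l * sup_emp w) * ln (expR (l * sup_emp w) / laplace l))
    = l * laplace' l - laplace l * ln (laplace l).
  rewrite /laplace' -meanZ (mulrC (laplace l)) /laplace -meanZ -meanB.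
  apply: eq_mean => w; rewrite ln_div ?posrE ?expR_gt0// expRK.
  by rewrite mulrBr [in LHS]mulrCA (mulrC (expR _) (sup_emp _)) (mulrC (expR _)).
move=> /le_trans; apply.
pose x i w := sup_emp w - sup_emp_but i w.
apply: (@le_trans _ _ (\sum_i (mean (fun w => t * (x i w * Y w)) +
    t * mean (fun w => U i w * (x i w ^+ 2 / 2 - x i w))))).
  apply: ler_sum => i _; rewrite -meanZ -meanD; apply: ler_mean => // w.
  rewrite ln_div ?posrE ?expR_gt0// !expRK -mulrBr -/(x i w).
  have YE : expR (l * sup_emp w) = U i w * expR (l * x i w).
    by rewrite -expRD -mulrDr /x addrC subrK.
  have := bousquet_pointwise l0 (sup_emp_increment_le1 i w).
  rewrite -/t -/(x i w) /Y YE; have := expR_ge0 (l * sup_emp_but i w).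
  rewrite -/(U i w); move: (expR (l * x i w)) (U i w) (x i w) => E u y u0 H.
  have := ler_wpM2l u0 H; lra.
rewrite big_split /= mulrDr lerD//.
  rewrite -mean_sum /laplace' -meanZ; apply: ler_mean => // w.
  rewrite -mulr_sumr ler_wpM2l// -mulr_suml ler_wpM2r ?expR_ge0//.
  exact: sum_sup_emp_increment.
rewrite -mulr_sumr ler_wpM2l//.
apply: (@le_trans _ _ (\sum_(i : I) s2 / 2 * laplace l)).
  by apply: ler_sum => i _; apply: mean_increment_le => //; exact: ltW.
by rewrite sumr_const -[leLHS]mulr_natl !mulrA.
Qed.

End SupEmpirical.

(** * Integration of the differential inequality *)

Section Bousquet.
Context {R : realType} {I J K : finType} (p : J -> R) (k0 : K) (f : K -> J -> R).
Context (s2 : R).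
Context (p_ge0 : forall j, 0 <= p j) (p_sum1 : \sum_j p j = 1).
Context (f_le1 : forall k j, f k j <= 1).
Context (f_mean0 : forall k, \sum_j p j * f k j = 0).
Context (s2_ge0 : 0 <= s2) (f_var : forall k, \sum_j p j * f k j ^+ 2 <= s2).
Implicit Types (w : {ffun I -> J}) (i : I) (l x : R).

Local Notation mean := (@mean R I J p).
Local Notation Z := (@sup_emp R I J K k0 f).
Local Notation F := (@laplace R I J K p k0 f).
Local Notation F' := (@laplace' R I J K p k0 f).
Local Notation v := (2 * mean Z + #|I|%:R * s2).

Let F_gt0 l : 0 < F l.
Proof. exact: laplace_gt0. Qed.

Let EZ_ge0 : 0 <= mean Z.
Proof. exact: mean_sup_emp_ge0. Qed.

Lemma is_derive_laplace l : is_derive l 1 F (F' l).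
Proof.
apply: is_derive_sumr => w; apply: is_derive_eq; rewrite /GRing.scale/=; ring.
Qed.

(** What the log-Laplace transform has in excess of that of a centered Poisson
    variable of parameter [v]; the latter turns the differential inequality into
    an equality. *)
Definition bousquet_gap l : R := ln (F l) - l * mean Z - v * (expR l - 1 - l).

Definition bousquet_gap' l : R := F' l / F l - mean Z - v * (expR l - 1).

Lemma is_derive_bousquet_gap l : is_derive l 1 bousquet_gap (bousquet_gap' l).
Proof.
have dF := is_derive_laplace l; have F0 := F_gt0 l.
have dln : is_derive l 1 (fun y => ln (F y)) (F' l / F l).
  by rewrite mulrC; exact: (is_derive1_comp (is_derive1_ln F0) dF).
rewrite /bousquet_gap; apply: is_derive_eq.
rewrite /GRing.scale/= /bousquet_gap'; ring.
Qed.

(** The solution of the homogeneous equation attached to the differential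
    inequality: with [h] this function, [h' = 2 * expR l - 1] and
    [l - bousquet_factor l = h / h']. *)
Definition bousquet_homog l : R := 2 * expR l - l - 2.

Lemma bousquet_homog_ge l : l <= bousquet_homog l.
Proof. by rewrite /bousquet_homog; have := expR_ge1Dx l; lra. Qed.

Lemma bousquet_gap_ode l : 0 < l ->
  bousquet_gap' l * bousquet_homog l - bousquet_gap l * (2 * expR l - 1) <= 0.
Proof.
move=> l0; have := @laplace_differential_ineq R I J K p k0 f s2
  p_ge0 p_sum1 f_le1 f_mean0 f_var l l0 s2_ge0.
have F0 := F_gt0 l; have e0 : 0 < 2 * expR l - 1 by have := expR_ge1Dx l; lra.
set t := bousquet_factor l; set r := F' l / F l => H.
have tE : t * (2 * expR l - 1) = 2 + 2 * (l - 1) * expR l.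
  by rewrite /t/bousquet_factor divfK// gt_eqF.
have {H} : l * r - ln (F l) <= t * (r + #|I|%:R * s2 / 2).
  have FE : F' l = r * F l by rewrite /r divfK// gt_eqF.
  by rewrite -(ler_pM2r F0); move: H; rewrite FE; lra.
rewrite -(ler_pM2r e0) -subr_le0 mulrAC tE; apply: le_trans.
rewrite /bousquet_gap' /bousquet_gap /bousquet_homog -/r.
by rewrite le_eqVlt; apply/orP; left; apply/eqP; field.
Qed.

(** The gap is of second order at [0]; this is the initial condition of the
    differential inequality, whose equation is singular there. *)
Lemma bousquet_gap_near0 : exists C M, [/\ 0 <= C, 0 < M &
  forall l, 0 < l -> l * M <= 2^-1 -> bousquet_gap l <= C * l ^+ 2].
Proof.
exists (2 * mean (fun w => Z w ^+ 2)), (1 + \sum_w `|Z w|).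
split.
- rewrite mulr_ge0// -(mean_cst p_sum1 (I:=I) 0); apply: ler_mean => // w.
  exact: sqr_ge0.
- by rewrite ltr_pwDl// sumr_ge0.
move=> l l0 lM.
have : F l <= 1 + l * mean Z + 2 * l ^+ 2 * mean (fun w => Z w ^+ 2).
  rewrite -[X in _ <= X + _ + _](mean_cst p_sum1 (I:=I)).
  rewrite -!meanZ -!meanD; apply: ler_mean => // w.
  apply: le_trans (expR_le_quadratic _) _.
    rewrite normrM (gtr0_norm l0); apply: le_trans lM.
    apply: ler_wpM2l; first exact: ltW.
    rewrite (bigD1 w)//= addrCA lerDl addr_ge0//.
    exact: sumr_ge0.
  by rewrite exprMn; lra.
have := ln_leB1 (F_gt0 l); have v0 : 0 <= v.
  by rewrite addr_ge0 ?mulr_ge0.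
have : 0 <= v * (expR l - 1 - l).
  by rewrite mulr_ge0//; have := expR_ge1Dx l; lra.
rewrite /bousquet_gap; lra.
Qed.

(** The quotient of the gap by the homogeneous solution is nonincreasing, and it
    tends to [0] at [0] since the gap is of second order while the homogeneous
    solution is at least [l]. *)
Lemma bousquet_gap_le0 l : 0 < l -> bousquet_gap l <= 0.
Proof.
move=> l0; pose q x := bousquet_gap x * (bousquet_homog x)^-1.
have h0 x : 0 < x -> 0 < bousquet_homog x.
  by move=> x0; exact: lt_le_trans (bousquet_homog_ge x).
have qni x : 0 < x -> x <= l -> q l <= q x.
  move=> x0 xl.
  apply: (@ger_of_derive_le0 _ q (fun y => (bousquet_gap' y * bousquet_homog y
    - bousquet_gap y * (2 * expR y - 1)) / bousquet_homog y ^+ 2)) => // y /andP[xy _].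
    have y0 := lt_le_trans x0 xy; have hy := h0 _ y0.
    have dgap := is_derive_bousquet_gap y.
    have ddenom : is_derive y 1 bousquet_homog (2 * expR y - 1).
      by rewrite /bousquet_homog; apply: is_derive_eq; rewrite /GRing.scale/=; ring.
    have dV := is_deriveV (lt0r_neq0 hy) ddenom.
    by rewrite /q; apply: is_derive_eq; rewrite /GRing.scale/=; field; exact: lt0r_neq0.
  have y0 := lt_le_trans x0 xy.
  by rewrite mulr_le0_ge0 ?bousquet_gap_ode// invr_ge0 sqr_ge0.
have [C [M [C0 M0 gapC]]] := bousquet_gap_near0.
suff : q l <= 0 by rewrite pmulr_lle0// invr_gt0 h0.
rewrite leNgt; apply/negP => ql0.
(* A point so close to 0 that the quotient at it is below its value at [l]. *)
pose x := Num.min l (Num.min ((2 * M)^-1) (q l / (2 * (C + 1)))).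
have x0 : 0 < x.
  by rewrite !lt_min l0 invr_gt0 mulr_gt0//= divr_gt0// mulr_gt0// ltr_wpDl.
have [xl xM xq] : [/\ x <= l, x <= (2 * M)^-1 & x <= q l / (2 * (C + 1))].
  by rewrite /x !ge_min !lexx !orbT.
have : q x <= C * x.
  rewrite ler_pdivrMr ?h0//; apply: le_trans (gapC _ x0 _) _.
    by rewrite -ler_pdivlMr// -invfM.
  by rewrite expr2 mulrA ler_wpM2l ?bousquet_homog_ge// mulr_ge0// ltW.
have := qni _ x0 xl; move: xq; rewrite ler_pdivlMr; last by rewrite mulr_gt0// ltr_wpDl.
by nra.
Qed.

Lemma log_laplace_le l : 0 < l -> ln (F l) <= l * mean Z + v * (expR l - 1 - l).
Proof. by move=> /bousquet_gap_le0; rewrite /bousquet_gap; lra. Qed.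

End Bousquet.

(** * Bousquet's concentration inequality *)

Section BousquetTail.
Context {R : realType} {I J K : finType} (p : J -> R) (k0 : K) (f : K -> J -> R).
Context (s2 : R).
Context (p_ge0 : forall j, 0 <= p j) (p_sum1 : \sum_j p j = 1).
Context (f_le1 : forall k j, f k j <= 1).
Context (f_mean0 : forall k, \sum_j p j * f k j = 0).
Context (s2_ge0 : 0 <= s2) (f_var : forall k, \sum_j p j * f k j ^+ 2 <= s2).

Local Notation mean := (@mean R I J p).
Local Notation Z := (@sup_emp R I J K k0 f).

(** Bousquet's inequality follows from Chernoff's bound and [bernstein_poly]. With
    [r = sqrt (v / (2 x))], the chosen [l] satisfies [1 - l / 3 = l * r], which makes
    the arithmetic-geometric inequality between [x * (1 - l / 3)] and
    [v * l ^+ 2 / (2 * (1 - l / 3))] an equality. *)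
Theorem sup_emp_tail (m v x : R) : mean Z <= m -> 0 < v ->
  2 * m + #|I|%:R * s2 <= v -> 0 < x ->
  \sum_(w | m + Num.sqrt (2 * x * v) + x / 3 <= Z w) weight p w <= expR (- x).
Proof.
move=> Zm v0 mv x0; set r := Num.sqrt (v / (2 * x)); set s := m + _ + _.
have x20 : 0 < 2 * x by rewrite mulr_gt0.
have r0 : 0 < r by rewrite sqrtr_gt0 divr_gt0.
have vE : v = 2 * x * r ^+ 2.
  by rewrite sqr_sqrtr ?divr_ge0 ?ltW// mulrC divfK// gt_eqF.
have sqrtE : Num.sqrt (2 * x * v) = 2 * x * r.
  rewrite vE mulrA -expr2 -exprMn sqrtr_sqr ger0_norm//.
  by rewrite mulr_ge0 ?ltW.
(* The optimal parameter of Chernoff's bound for a Bernstein-type transform. *)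
set l := (3^-1 + r)^-1.
have l0 : 0 < l by rewrite invr_gt0 addr_gt0.
have lE : l * (3^-1 + r) = 1 by rewrite mulVf// gt_eqF// addr_gt0.
have logF : ln (laplace (I := I) p k0 f l) <= l * m + x * r * l.
  apply: le_trans (log_laplace_le k0 p_ge0 p_sum1 f_le1 f_mean0 s2_ge0 f_var l0) _.
  have ph0 : 0 <= expR l - 1 - l by have := expR_ge1Dx l; lra.
  have phi : v * (expR l - 1 - l) <= x * r * l.
    have := bernstein_poly (ltW l0).
    (* This is [1 - l / 3 = l * r], the defining property of [l]. *)
    have -> : 2 - 2 * l / 3 = 2 * (l * r) by move: lE; lra.
    rewrite vE; set ph := expR l - 1 - l => H.
    have H2 : 2 * r * ph <= l by rewrite -(ler_pM2l l0); move: H; lra.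
    have := ler_wpM2l (ltW (mulr_gt0 x0 r0)) H2; lra.
  apply: le_trans (_ : l * mean Z + (v - 2 * m + 2 * mean Z) * (expR l - 1 - l) <= _).
    by rewrite lerD2l ler_wpM2r//; lra.
  have : 0 <= (l + 2 * (expR l - 1 - l)) * (m - mean Z).
    by rewrite mulr_ge0 ?subr_ge0// addr_ge0 ?mulr_ge0// ltW.
  lra.
apply: (@le_trans _ _ (expR (- (l * s)) * laplace (I := I) p k0 f l)).
  rewrite -meanZ /mean [leLHS]big_mkcond /=; apply: ler_sum => w _.
  case: ifP => [sZ|_]; last by rewrite mulr_ge0 ?weight_ge0// mulr_ge0 ?expR_ge0.
  rewrite ler_peMr ?weight_ge0// -expRD.
  by rewrite -expR0 ler_expR addrC subr_ge0 ler_pM2l.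
rewrite -[X in _ * X]lnK ?posrE ?laplace_gt0// -expRD ler_expR.
move: logF; rewrite /s sqrtE.
have : x * (l * (3^-1 + r)) = x by rewrite lE mulr1.
lra.
Qed.

End BousquetTail.

(** * The chi-square statistic on the space of cell labels *)

Section ChiSquare.
Context {R : realType} {I J : finType} (p : J -> R).
Context (p_gt0 : forall j, 0 < p j) (p_sum1 : \sum_j p j = 1).
Context (I_gt0 : (0 < #|I|)%N).
Implicit Types (w : {ffun I -> J}) (i : I) (j : J) (g : J -> R).

Local Notation mean := (@mean R I J p).
Local Notation n := (#|I|%:R : R).
Local Notation D := (#|J|.-1%:R : R).

Let p_ge0 j : 0 <= p j. Proof. exact: ltW. Qed.
Let n_gt0 : 0 < n. Proof. by rewrite ltr0n. Qed.

Definition freq_dev w j : R := (\sum_i (w i == j)%:R) / #|I|%:R - p j.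

Definition chi2 w : R := \sum_j freq_dev w j ^+ 2 / p j.

Definition chi w : R := Num.sqrt (chi2 w).

Lemma chi2_ge0 w : 0 <= chi2 w.
Proof. by apply: sumr_ge0 => j _; rewrite divr_ge0 ?sqr_ge0. Qed.

Lemma sqr_chi w : chi w ^+ 2 = chi2 w.
Proof. by rewrite sqr_sqrtr ?chi2_ge0. Qed.

Lemma mul_freq_dev w j : n * freq_dev w j = \sum_i ((w i == j)%:R - p j).
Proof.
rewrite sumrB sumr_const -[p j *+ _]mulr_natl /freq_dev mulrBr; congr (_ - _).
by rewrite mulrC divfK// gt_eqF.
Qed.

Lemma sum_freq_dev w : \sum_j freq_dev w j = 0.
Proof.
apply: (mulfI (lt0r_neq0 n_gt0)); rewrite mulr0 mulr_sumr.
under eq_bigr do rewrite mul_freq_dev.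
rewrite exchange_big big1//= => i _; rewrite sumrB p_sum1 (bigD1 (w i))//= eqxx.
by rewrite big1 ?addr0 ?subrr// => j /negPf; rewrite eq_sym => ->.
Qed.

(** The function [g] being centered, the sum is not changed when the counts of the
    cells are replaced by their deviations from their means. *)
Lemma sum_sample w g : \sum_j p j * g j = 0 ->
  \sum_i g (w i) = n * \sum_j freq_dev w j * g j.
Proof.
move=> g0; rewrite mulr_sumr; under [RHS]eq_bigr do rewrite mulrA mul_freq_dev.
rewrite (eq_bigr (fun j => \sum_i ((w i == j)%:R - p j) * g j)); last first.
  by move=> j _; rewrite mulr_suml.
rewrite exchange_big; apply: eq_bigr => i _ /=.
under eq_bigr do rewrite mulrBl.
rewrite sumrB g0 subr0 (bigD1 (w i))//= eqxx mul1r.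
by rewrite big1 ?addr0// => j /negPf; rewrite eq_sym => ->; rewrite mul0r.
Qed.

(** The Cauchy-Schwarz inequality for the weights [p], between [freq_dev w / p] and
    [g]; it makes [chi] the dual norm of the empirical process. *)
Lemma sum_sample_le_chi w g c : 0 < c -> \sum_j p j * g j = 0 ->
  \sum_j p j * g j ^+ 2 <= c ^+ 2 -> \sum_i g (w i) <= n * (chi w * c).
Proof.
move=> c0 g0 gc; rewrite sum_sample// ler_pM2l//.
set S := \sum_j _ * _; set C := chi w; have C0 : 0 <= C by exact: sqrtr_ge0.
have : 0 <= \sum_j p j * (c * (freq_dev w j / p j) - C * g j) ^+ 2.
  by apply: sumr_ge0 => j _; rewrite mulr_ge0 ?sqr_ge0.
have -> : \sum_j p j * (c * (freq_dev w j / p j) - C * g j) ^+ 2 =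
    c ^+ 2 * chi2 w - 2 * c * C * S + C ^+ 2 * \sum_j p j * g j ^+ 2.
  rewrite /chi2 /S !mulr_sumr -sumrB -big_split /=.
  by apply: eq_bigr => j _; field; exact: lt0r_neq0.
rewrite -sqr_chi -/C; have [C_eq0 _|C_neq0] := eqVneq C 0.
  have dev0 j : freq_dev w j = 0.
    have : chi2 w = 0 by rewrite -sqr_chi -/C C_eq0 expr0n.
    move/psumr_eq0P => /(_ (fun j _ => divr_ge0 (sqr_ge0 _) (p_ge0 j))).
    move=> /(_ j isT)/eqP; rewrite mulf_eq0 invr_eq0 (gt_eqF (p_gt0 j)) orbF.
    by rewrite sqrf_eq0 => /eqP.
  by rewrite /S big1 ?C_eq0 ?mul0r// => j _; rewrite dev0 mul0r.
have C1 : 0 < C by rewrite lt_neqAle eq_sym C_neq0.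
have := ler_wpM2l (sqr_ge0 C) gc; set V := \sum_j _ * _ => H1 H2.
have cC : 0 < 2 * (c * C) by rewrite !mulr_gt0.
by rewrite -(ler_pM2l cC); move: H1 H2; lra.
Qed.

(** The terms of a sum of independent centered variables are orthogonal. *)
Lemma mean_sqr_sum g : \sum_j p j * g j = 0 ->
  mean (fun w => (\sum_i g (w i)) ^+ 2) = n * \sum_j p j * g j ^+ 2.
Proof.
move=> g0; under eq_mean => w do rewrite expr2 mulr_suml.
rewrite mean_sum mulr_natl -sumr_const; apply: eq_bigr => i _.
under eq_mean => w do rewrite mulr_sumr.
rewrite mean_sum (bigD1 i)//= big1 ?addr0; last first.
  move=> k ki; rewrite -(mean_avg p_sum1 i) -(mean_cst p_sum1 0 (I := I)).
  apply: eq_mean => w; rewrite -[RHS](mulr0 (g (w k))) -g0 mulr_sumr.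
  by apply: eq_bigr => j _; rewrite !ffunE eqxx (negPf ki) mulrA mulrC.
rewrite -(mean_coord p_sum1 i); apply: eq_mean => w; exact: expr2.
Qed.

Lemma mean_chi2 : mean chi2 = D / n.
Proof.
rewrite /chi2 mean_sum.
have -> : D = \sum_j (1 - p j).
  rewrite sumrB p_sum1 sumr_const; apply/eqP; rewrite eq_sym subr_eq natr1.
  rewrite prednK//; apply/card_gt0P; apply/existsP; rewrite -[X in is_true X]negbK.
  apply/negP => /existsPn J0; move: p_sum1; rewrite big_pred0 => [/eqP|].
    by rewrite eq_sym oner_eq0.
  by move=> j; have := J0 j.
rewrite mulr_suml; apply: eq_bigr => j _.
pose g a : R := (a == j)%:R - p j.
have sg : \sum_a p a * (a == j)%:R = p j.
  by rewrite (bigD1 j)//= eqxx mulr1 big1 ?addr0// => a /negPf ->; rewrite mulr0.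
have g0 : \sum_a p a * g a = 0.
  under eq_bigr do rewrite mulrBr.
  by rewrite sumrB sg -mulr_suml p_sum1 mul1r subrr.
have := mean_sqr_sum g0.
have -> : \sum_a p a * g a ^+ 2 = p j * (1 - p j).
  rewrite (eq_bigr (fun a => (1 - 2 * p j) * (p a * (a == j)%:R) + p j ^+ 2 * p a)).
    by rewrite big_split /= -!mulr_sumr sg p_sum1; ring.
  by move=> a _; rewrite /g; case: (a == j) => /=; ring.
move=> H; transitivity (mean (fun w => (n ^+ 2 * p j)^-1 * (\sum_i g (w i)) ^+ 2)).
  apply: eq_mean => w; rewrite -mul_freq_dev.
  by field; rewrite !lt0r_neq0.
by rewrite meanZ H; field; rewrite !lt0r_neq0.
Qed.

(** [E chi <= sqrt (E chi2)], by nonnegativity of the variance. *)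
Lemma mean_chi_le : mean chi <= Num.sqrt (D / n).
Proof.
have chi0 : 0 <= mean chi.
  rewrite -(mean_cst p_sum1 0 (I := I)); apply: ler_mean => // w; exact: sqrtr_ge0.
rewrite -[leLHS]ger0_norm// -sqrtr_sqr ler_wsqrtr//.
have : 0 <= mean (fun w => (chi w - mean chi) ^+ 2).
  by rewrite -(mean_cst p_sum1 0 (I := I)); apply: ler_mean => // w; exact: sqr_ge0.
have -> : mean (fun w => (chi w - mean chi) ^+ 2) =
    mean (fun w => chi2 w + (mean chi ^+ 2 + (- (2 * mean chi)) * chi w)).
  by apply: eq_mean => w; rewrite -sqr_chi; ring.
rewrite !meanD mean_cst// meanZ mean_chi2; lra.
Qed.

Definition dev_within w (theta : R) : bool :=
  [forall j, `|freq_dev w j| <= theta * p j].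

(** The class of functions given to Bousquet's inequality consists of the maximizers
    attached to the samples of the event, divided by [b = theta / z] to be at most
    1, together with the zero function, indexed by [None], which keeps the class
    nonempty. The supremum is at most [n * chi / b], and at least [n * z / b] on the event.
    As [z] appears on both sides, the hypothesis is a fixed-point condition. *)
Theorem chi_tail (z theta x : R) : 0 < z -> 0 < theta -> 0 < x ->
  Num.sqrt (D / n)
  + Num.sqrt (2 * x / n + 4 * x * (theta / z) * Num.sqrt (D / n) / n)
  + theta / z * x / (3 * n) <= z ->
  \sum_(w | dev_within w theta && (z <= chi w)) weight p w <= expR (- x).
Proof.
move=> z0 th0 x0 Hz; set s := Num.sqrt (D / n) in Hz *.
have b0 : 0 < theta / z by exact: divr_gt0.
have bz : theta = theta / z * z by rewrite divfK// gt_eqF.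
move: (theta / z) b0 bz Hz => b b0 bz Hz.
pose bad w := dev_within w theta && (z <= chi w).
pose f (k : option {ffun I -> J}) j : R :=
  if k is Some w then if bad w then freq_dev w j / (p j * chi w * b) else 0
  else 0.
have f_le1 k j : f k j <= 1.
  rewrite /f; case: k => // w; case: ifP => // /andP[/forallP/(_ j) dw zw].
  have c0 := lt_le_trans z0 zw.
  rewrite ler_pdivrMr ?mul1r; last by rewrite !mulr_gt0.
  apply: le_trans (ler_norm _) (le_trans dw _).
  rewrite bz [leRHS](_ : _ = b * p j * chi w); last by ring.
  by rewrite mulrAC ler_pM2l// mulr_gt0.
have f_mean0 k : \sum_j p j * f k j = 0.
  case: k => [w|]; last by rewrite big1// => j _; rewrite mulr0.
  rewrite /f; case: (boolP (bad w)) => [/andP[_ zw]|_]; last first.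
    by rewrite big1// => j _; rewrite mulr0.
  have c0 := lt_le_trans z0 zw.
  rewrite (eq_bigr (fun j => freq_dev w j / (chi w * b))).
    by rewrite -mulr_suml sum_freq_dev mul0r.
  by move=> j _; field; rewrite !lt0r_neq0.
have f_var k : \sum_j p j * f k j ^+ 2 <= b^-1 ^+ 2.
  case: k => [w|]; last by rewrite big1 ?sqr_ge0// => j _; rewrite expr0n mulr0.
  rewrite /f; case: (boolP (bad w)) => [/andP[_ zw]|_]; last first.
    by rewrite big1 ?sqr_ge0// => j _; rewrite expr0n mulr0.
  have c0 := lt_le_trans z0 zw.
  rewrite (eq_bigr (fun j => freq_dev w j ^+ 2 / p j * (chi w * b) ^- 2)).
    rewrite -mulr_suml -/(chi2 w) -sqr_chi le_eqVlt; apply/orP; left; apply/eqP.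
    by field; rewrite !lt0r_neq0.
  by move=> j _; field; rewrite !lt0r_neq0.
have Z_le w : sup_emp None f w <= n * (chi w * b^-1).
  rewrite /sup_emp; have [k ->] := fmax_attained None (fun k => \sum_i f k (w i)).
  by apply: sum_sample_le_chi; rewrite ?invr_gt0.
have Z_ge w : bad w -> n * z / b <= sup_emp None f w.
  move=> bw; apply: le_trans (fmax_ge None (fun k => \sum_i f k (w i)) (Some w)).
  rewrite (sum_sample _ (f_mean0 (Some w))) /f bw.
  have /andP[_ zw] := bw; have c0 := lt_le_trans z0 zw.
  rewrite (eq_bigr (fun j => freq_dev w j ^+ 2 / p j * (chi w * b)^-1)).
    rewrite -mulr_suml -/(chi2 w) -sqr_chi -mulrA ler_pM2l//.
    rewrite [leRHS](_ : _ = chi w / b); last by field; rewrite !lt0r_neq0.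
    by rewrite ler_pM2r ?invr_gt0.
  by move=> j _; field; rewrite !lt0r_neq0.
have EZ : mean (sup_emp None f) <= n * s / b.
  apply: (@le_trans _ _ (n / b * mean chi)).
    by rewrite -meanZ; apply: ler_mean => // w; rewrite -mulrA (mulrC b^-1).
  by rewrite (mulrAC n s) ler_pM2l ?divr_gt0// mean_chi_le.
have s0 : 0 <= s by exact: sqrtr_ge0.
pose v := 2 * (n * s / b) + n * b^-1 ^+ 2.
have v0 : 0 < v.
  apply: ltr_wpDl; last by rewrite mulr_gt0// exprn_gt0// invr_gt0.
  by rewrite mulr_ge0// divr_ge0 ?mulr_ge0// ltW.
have thr : n * s / b + Num.sqrt (2 * x * v) + x / 3 <= n * z / b.
  have nb0 : 0 < n / b by exact: divr_gt0.
  rewrite (_ : 2 * x * v = (n / b) ^+ 2 * (2 * x / n + 4 * x * b * s / n)); last first.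
    by rewrite /v; field; rewrite !lt0r_neq0.
  rewrite sqrtrM ?sqr_ge0// sqrtr_sqr (gtr0_norm nb0).
  rewrite [leRHS](_ : _ = n / b * z); last by rewrite mulrAC.
  apply: le_trans (ler_wpM2l (ltW nb0) Hz); rewrite !mulrDr.
  by rewrite le_eqVlt; apply/orP; left; apply/eqP; field; rewrite !lt0r_neq0.
apply: le_trans (sup_emp_tail p_ge0 p_sum1 f_le1 f_mean0 (sqr_ge0 _) f_var EZ
  v0 (lexx _) x0).
rewrite [leLHS]big_mkcond [leRHS]big_mkcond; apply: ler_sum => w _.
case: ifP => [bw|_]; last by case: ifP => // _; exact: weight_ge0.
by rewrite (le_trans thr (Z_ge _ bw)).
Qed.

End ChiSquare.

(** * From the sample to the cell labels *)

(** An event that depends on a finitely valued variable is the finite disjoint union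
    of fibers of this variable. *)
Lemma measure_preim_fin {d : measure_display} {T : measurableType d}
    {R : realType} (Pr : probability T R) (V : finType) (L : T -> V) (S : pred V) :
  (forall v, measurable [set t | L t = v]) ->
  measurable [set t | S (L t)] /\
  Pr [set t | S (L t)] = (\sum_(v | S v) Pr [set t | L t = v])%E.
Proof.
move=> mL.
have -> : [set t | S (L t)] = \bigcup_(v in [set v | S v]) [set t | L t = v].
  by apply/seteqP; split => [t St|t [v /= Sv /= ->]//]; exists (L t).
have finS : finite_set [set v | S v] by exact: finite_finset.
split; first exact: fin_bigcup_measurable.
rewrite measure_fin_bigcup//; last first.
  by move=> u v _ _ [t [/= <- <-]].
rewrite (@fsbigE _ _ _ _ _ (enum S)) ?enum_uniq//.
- rewrite big_enum_cond; apply: eq_bigl => v.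
  by apply/andP/idP => [[]//|Sv]; rewrite !inE.
- by move=> v /=; rewrite mem_enum.
- by move=> v /= Sv; rewrite mem_enum => /negP; case.
Qed.

Section Partition.
Context {d : measure_display} {Z : measurableType d} {R : realType}
  (mu P : probability Z R) (D : nat) (La : 'I_D.+1 -> set Z).
Context (hLa : histogram_partition mu La) (hP : forall i, (0 < P (La i))%E).
Implicit Types (z : Z) (j : 'I_D.+1).

Lemma cell_exists z : exists j, La j z.
Proof.
have : (\bigcup_j La j) z by rewrite (cell_cover hLa).
by move=> [j _]; exists j.
Qed.

Definition cell_of z : 'I_D.+1 := sval (cid (cell_exists z)).

Lemma cell_ofP z j : (cell_of z == j) = (z \in La j).
Proof.
have h := svalP (cid (cell_exists z)); rewrite -/(cell_of z) in h.
apply/eqP/idP => [<-|]; first by rewrite inE.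
rewrite inE => zj; by apply: (cell_disjoint hLa) => //; exists z.
Qed.

Lemma cell_set_eq j : [set z | cell_of z = j] = La j.
Proof.
apply/seteqP; split=> z /=; first by move/eqP; rewrite cell_ofP inE.
by move=> zj; apply/eqP; rewrite cell_ofP inE.
Qed.

Definition cell_prob j : R := fine (P (La j)).

Lemma cell_prob_gt0 j : 0 < cell_prob j.
Proof.
by rewrite fine_gt0// hP ltey_eq fin_num_measure//; exact: cell_measurable hLa _.
Qed.

Lemma EFin_cell_prob j : (cell_prob j)%:E = P (La j).
Proof. by rewrite fineK// fin_num_measure//; exact: cell_measurable hLa _. Qed.

Lemma sum_cell_prob : \sum_j cell_prob j = 1.
Proof.
apply: EFin_inj; rewrite -sumEFin -(probability_setT P).
have mcell j : measurable [set z | cell_of z = j].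
  by rewrite cell_set_eq; exact: cell_measurable hLa _.
have [_ /=] := measure_preim_fin P xpredT mcell.
have -> : [set t : Z | true] = setT by apply/seteqP; split.
by move=> ->; apply: eq_bigr => j _; rewrite cell_set_eq EFin_cell_prob.
Qed.

Lemma hist_densityE (Q : set Z -> \bar R) z :
  hist_density mu La Q z = fine (Q (La (cell_of z))) / fine (mu (La (cell_of z))).
Proof.
rewrite /hist_density (bigD1 (cell_of z))//= big1 ?addr0.
  by rewrite indicE -cell_ofP eqxx mulr1.
by move=> j /negPf jz; rewrite indicE -cell_ofP eq_sym jz mulr0.
Qed.

(** The integrand is constant on each cell, so that the integral is a finite sum. *)
Lemma chi2_statE (Q : set Z -> \bar R) :
  chi2_stat mu La P Q = \sum_j (fine (Q (La j)) - cell_prob j) ^+ 2 / cell_prob j.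
Proof.
pose m j : R := fine (mu (La j)).
have m0 j : 0 < m j.
  rewrite fine_gt0// (cell_gt0 hLa) ltey_eq fin_num_measure//.
  exact: cell_measurable hLa _.
have mE j : (m j)%:E = mu (La j).
  by rewrite fineK// fin_num_measure//; exact: cell_measurable hLa _.
pose c j := (fine (Q (La j)) - cell_prob j) ^+ 2 / cell_prob j / m j.
have c0 j : 0 <= c j by rewrite !divr_ge0 ?sqr_ge0// ltW// cell_prob_gt0.
rewrite /chi2_stat /Rintegral.
have -> : (fun z => ((hist_density mu La Q z - hist_density mu La P z) ^+ 2 /
    hist_density mu La P z)%:E) = (fun z => \sum_j (c j * \1_(La j) z)%:E)%E.
  apply/funext => z; rewrite !hist_densityE sumEFin; congr (_%:E).
  rewrite (bigD1 (cell_of z))//= big1 ?addr0; last first.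
    by move=> j /negPf jz; rewrite indicE -cell_ofP eq_sym jz mulr0.
  rewrite indicE -cell_ofP eqxx mulr1 /c -/(m _) -/(cell_prob _).
  by field; rewrite !lt0r_neq0// cell_prob_gt0.
rewrite ge0_integral_sum//; last 2 first.
- move=> j; apply/measurable_EFinP; apply: measurable_funM => //.
  by apply: measurable_indic; exact: cell_measurable hLa _.
- by move=> j z _; rewrite lee_fin mulr_ge0.
rewrite (eq_bigr (fun j => (c j * m j)%:E)).
  rewrite sumEFin /=; apply: eq_bigr => j _.
  by rewrite /c divfK// lt0r_neq0.
move=> j _; under eq_integral do rewrite EFinM.
rewrite ge0_integralZl_EFin//; last first.
  by apply/measurable_EFinP; apply: measurable_indic; exact: cell_measurable hLa _.
rewrite integral_indic//; last exact: cell_measurable hLa _.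
by rewrite setIT [RHS]EFinM; congr (_ * _)%E; exact: esym (mE j).
Qed.

End Partition.

Section Labels.
Context {d d' : measure_display} {T : measurableType d} {Z : measurableType d'}
  {R : realType} {Pr : probability T R} {n : nat}
  (mu P : probability Z R) (D : nat) (La : 'I_D.+1 -> set Z)
  (xi : 'I_n -> {RV Pr >-> Z}).
Context (hLa : histogram_partition mu La) (hP : forall i, (0 < P (La i))%E)
  (hxi : iid_with_law xi P).
Implicit Types (w : T) (v : {ffun 'I_n -> 'I_D.+1}).

Local Notation p := (cell_prob P La).

Definition labels w : {ffun 'I_n -> 'I_D.+1} := [ffun i => cell_of hLa (xi i w)].

Lemma labels_fiber v : [set w | labels w = v] =
  \bigcap_(i in [set i | i \in [set: 'I_n]%SET]) (xi i @^-1` La (v i)).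
Proof.
apply/seteqP; split => [w <- i _|w wv] /=.
  by rewrite ffunE; apply/set_mem; rewrite -(cell_ofP hLa) eqxx.
apply/ffunP => i; rewrite ffunE; apply/eqP; rewrite cell_ofP inE; apply: wv.
by rewrite /= finset.inE.
Qed.

Lemma measurable_labels v : measurable [set w | labels w = v].
Proof.
rewrite labels_fiber; apply: fin_bigcap_measurable; first exact: finite_finset.
move=> i _; rewrite -[X in measurable X]setTI; apply: measurable_funP => //.
exact: cell_measurable hLa _.
Qed.

(** This is mutual independence for the full index set. *)
Lemma labels_law v : Pr [set w | labels w = v] = (weight p v)%:E.
Proof.
have mLa j : measurable (La j) by exact: cell_measurable hLa j.
rewrite labels_fiber (hxi.1 _ (fun i => La (v i)))// /weight -prodEFin.
apply: eq_big => i; first by rewrite finset.inE.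
by move=> _; rewrite (EFin_cell_prob P hLa); exact: (hxi.2 i _ (mLa (v i))).
Qed.

Lemma labels_event (S : pred {ffun 'I_n -> 'I_D.+1}) :
  measurable [set w | S (labels w)] /\
  Pr [set w | S (labels w)] = (\sum_(v | S v) weight p v)%:E.
Proof.
have [mS ->] := measure_preim_fin Pr S measurable_labels; split => //.
by rewrite -sumEFin; apply: eq_bigr => v _; rewrite labels_law.
Qed.

Lemma empirical_dev w j :
  fine (empirical xi w (La j)) - fine (P (La j)) = freq_dev p (labels w) j.
Proof.
rewrite /freq_dev -/(cell_prob P La j); congr (_ - _).
rewrite /empirical (eq_bigr (fun i => ((labels w i == j)%:R : R)%:E)).
  by rewrite sumEFin -EFinM /= mulrC card_ord.
by move=> i _; rewrite diracE ffunE cell_ofP.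
Qed.

Lemma chi_statE w : chi_stat mu La P (empirical xi w) = chi p (labels w).
Proof.
rewrite /chi_stat chi2_statE//; congr Num.sqrt.
by apply: eq_bigr => j _; rewrite empirical_dev.
Qed.

Lemma Omega_mE w theta :
  \1_(Omega_m xi P La theta) w = (dev_within p (labels w) theta)%:R :> R.
Proof.
rewrite indicE; congr (_%:R); congr nat_of_bool; apply/idP/forallP.
  by rewrite inE => h j; have := h j I; rewrite /= empirical_dev.
by move=> h; rewrite inE => j _ /=; rewrite empirical_dev; exact: h.
Qed.

End Labels.

(** * Comparison of the thresholds and conclusion *)

Section Thresholds.
Context {R : realType} (n D : nat) (x theta : R).
Context (n_gt0 : (0 < n)%N) (x_gt0 : 0 < x) (theta_gt0 : 0 < theta).

Definition sharp_threshold : R :=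
  Num.sqrt (D%:R / n%:R) + Num.sqrt (2 * x / n%:R)
  + 2 * Num.sqrt (theta / n%:R) * Num.min (Num.sqrt x) ((x * D%:R / 2) `^ 4^-1)
  + theta / 3 * Num.sqrt (x / n%:R) * capped_sqrt_ratio x D.

Let N_gt0 : 0 < n%:R :> R. Proof. by rewrite ltr0n. Qed.
Let D_ge0 : 0 <= D%:R :> R. Proof. exact: ler0n. Qed.

Let sqrt2_gt0 : 0 < Num.sqrt 2 :> R. Proof. by rewrite sqrtr_gt0. Qed.

Lemma capped_sqrt_ratio_ge0 : 0 <= capped_sqrt_ratio x D.
Proof.
rewrite /capped_sqrt_ratio; case: ifP => _.
  by rewrite invr_ge0 ltW.
by rewrite le_min sqrtr_ge0 invr_ge0 ltW.
Qed.

Lemma capped_sqrt_ratio_le : capped_sqrt_ratio x D <= (Num.sqrt 2)^-1.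
Proof. by rewrite /capped_sqrt_ratio; case: ifP => // _; rewrite ge_min lexx orbT. Qed.

Lemma min_power_ge0 : 0 <= Num.min (Num.sqrt x) ((x * D%:R / 2) `^ 4^-1).
Proof. by rewrite le_min sqrtr_ge0 powR_ge0. Qed.

Lemma sharp_threshold_ge :
  Num.sqrt (D%:R / n%:R) + Num.sqrt (2 * x / n%:R) <= sharp_threshold.
Proof.
rewrite /sharp_threshold -!addrA lerD2l lerDl addr_ge0//.
  by rewrite !mulr_ge0 ?sqrtr_ge0 ?min_power_ge0.
by rewrite mulr_ge0 ?capped_sqrt_ratio_ge0// mulr_ge0 ?sqrtr_ge0// divr_ge0// ltW.
Qed.

Lemma sharp_threshold_gt0 : 0 < sharp_threshold.
Proof.
apply: lt_le_trans sharp_threshold_ge; rewrite ltr_wpDl ?sqrtr_ge0//.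
by rewrite sqrtr_gt0 divr_gt0// mulr_gt0.
Qed.

Let sqr_sqrt2 : Num.sqrt 2 * Num.sqrt 2 = 2 :> R.
Proof. by rewrite -expr2 sqr_sqrtr. Qed.

Let sqrt2xn : Num.sqrt (2 * x / n%:R) = Num.sqrt 2 * Num.sqrt (x / n%:R).
Proof. by rewrite -mulrA sqrtrM. Qed.

Lemma sharp_threshold_le : sharp_threshold <=
  Num.sqrt (D%:R / n%:R) + (1 + Num.sqrt (2 * theta) + theta / 6)
    * Num.sqrt (2 * x / n%:R).
Proof.
set q := Num.sqrt (2 * x / n%:R); set t := Num.sqrt (2 * theta).
have -> : (1 + t + theta / 6) * q = q + (t * q + theta / 6 * q) by ring.
rewrite /sharp_threshold -/q -!addrA !lerD2l {}/q {}/t; apply: lerD.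
  apply: (@le_trans _ _ (2 * Num.sqrt (theta / n%:R) * Num.sqrt x)).
    by rewrite ler_wpM2l ?mulr_ge0 ?sqrtr_ge0// ge_min lexx.
  rewrite sqrt2xn !sqrtrM ?(ltW x_gt0) ?(ltW theta_gt0)// -[X in X * _ * _]sqr_sqrt2.
  by rewrite le_eqVlt; apply/orP; left; apply/eqP; ring.
rewrite sqrt2xn; set y := Num.sqrt (x / n%:R).
have y0 : 0 <= theta / 3 * y by rewrite mulr_ge0 ?sqrtr_ge0// divr_ge0// ltW.
apply: le_trans (ler_wpM2l y0 capped_sqrt_ratio_le) _.
rewrite (_ : (Num.sqrt 2)^-1 = Num.sqrt 2 / 2); last first.
  by rewrite -[X in _ / X]sqr_sqrt2; field; exact: lt0r_neq0.
by rewrite le_eqVlt; apply/orP; left; apply/eqP; field.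
Qed.

(** The sharp threshold satisfies the condition of [chi_tail]. In the two terms that
    contain [theta / z], either [z >= sqrt (D / n)] or [z >= sqrt (2 x / n)] is used,
    and each choice gives one side of the corresponding minimum; when [D = 0] only
    the second choice is available in the last term. *)
Lemma sharp_threshold_fixpoint (z := sharp_threshold) :
  Num.sqrt (D%:R / n%:R)
  + Num.sqrt (2 * x / n%:R
      + 4 * x * (theta / z) * Num.sqrt (D%:R / n%:R) / n%:R)
  + theta / z * x / (3 * n%:R) <= z.
Proof.
have z0 : 0 < z := sharp_threshold_gt0.
have zge := sharp_threshold_ge; rewrite -/z in zge.
set s := Num.sqrt (D%:R / n%:R) in zge *.
have s0 : 0 <= s by exact: sqrtr_ge0.
have q0 : 0 <= Num.sqrt (2 * x / n%:R) by exact: sqrtr_ge0.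
have sz : s <= z by lra.
have qz : Num.sqrt (2 * x / n%:R) <= z by lra.
set y := Num.sqrt (x / n%:R).
have y0 : 0 < y by rewrite sqrtr_gt0 divr_gt0.
have y2 : y * y = x / n%:R by rewrite -expr2 sqr_sqrtr// divr_ge0// ltW.
have B0 : 0 <= 4 * x * (theta / z) * s / n%:R.
  by rewrite divr_ge0 ?(ltW N_gt0)// !mulr_ge0 ?invr_ge0// ltW.
have zE : z = sharp_threshold by [].
rewrite [leRHS]zE /sharp_threshold -/s -/y; apply: lerD; last first.
  have -> : theta / z * x / (3 * n%:R) = theta / 3 * (y * y / z).
    by rewrite y2; field; rewrite !lt0r_neq0.
  rewrite -[leRHS]mulrA ler_wpM2l ?divr_ge0 ?(ltW theta_gt0)//.
  rewrite -[leLHS]mulrA ler_pM2l// ler_pdivrMr//.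
  have yq : y <= (Num.sqrt 2)^-1 * z.
    by rewrite mulrC ler_pdivlMr// mulrC -sqrt2xn.
  rewrite /capped_sqrt_ratio; case: eqVneq => // D0.
  rewrite minr_pMl ?(ltW z0)// le_min yq andbT.
  have Dp : 0 < D%:R :> R by rewrite ltr0n lt0n.
  rewrite (_ : y = Num.sqrt (x / D%:R) * s); first by rewrite ler_wpM2l ?sqrtr_ge0.
  rewrite -sqrtrM ?divr_ge0 ?(ltW x_gt0)//; congr Num.sqrt; field.
  by rewrite !lt0r_neq0.
apply: le_trans (lerD (lexx _) (sqrtD_le _ B0)) _.
  by rewrite divr_ge0 ?mulr_ge0 ?ltW.
rewrite addrA lerD2l.
have th_n : 0 <= theta / n%:R by rewrite divr_ge0 ?ltW.
have t2 : Num.sqrt (2 ^+ 2 * (theta / n%:R)) = 2 * Num.sqrt (theta / n%:R).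
  by rewrite sqrtrM// sqrtr_sqr ger0_norm.
rewrite -t2 powR4_sqrt ?divr_ge0 ?mulr_ge0 ?(ltW x_gt0)//.
have t20 : 0 <= 2 ^+ 2 * (theta / n%:R) by rewrite mulr_ge0.
have BE : 4 * x * (theta / z) * s / n%:R = 2 ^+ 2 * (theta / n%:R) * (x * s / z).
  by field; rewrite !lt0r_neq0.
rewrite BE sqrtrM// ler_wpM2l ?sqrtr_ge0// le_min; apply/andP; split.
  by rewrite ler_wsqrtr// ler_pdivrMr// ler_wpM2l// ltW.
rewrite ler_wsqrtr// ler_pdivrMr//.
apply: (@le_trans _ _ (Num.sqrt (x * D%:R / 2) * Num.sqrt (2 * x / n%:R))).
  rewrite -sqrtrM ?divr_ge0 ?mulr_ge0 ?(ltW x_gt0)//.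
  rewrite (_ : _ * (2 * x / n%:R) = x ^+ 2 * (D%:R / n%:R)); last first.
    by field; rewrite lt0r_neq0.
  by rewrite sqrtrM ?sqr_ge0// sqrtr_sqr (gtr0_norm x_gt0).
by rewrite ler_wpM2l ?sqrtr_ge0.
Qed.

End Thresholds.

Theorem proposition4p2 (R : realType)
  (d : measure_display) (T : measurableType d) (Pr : probability T R)
  (d' : measure_display) (Z : measurableType d')
  (mu P : probability Z R) (fstar : Z -> R)
  (hf : is_density mu P fstar)
  (n : nat) (hn : (1 <= n)%N)
  (xi : 'I_n -> {RV Pr >-> Z}) (hxi : iid_with_law xi P)
  (D : nat) (La : 'I_D.+1 -> set Z) (hLa : histogram_partition mu La)
  (hP : forall i, (0 < P (La i))%E)
  (x theta : R) (hx : 0 < x) (htheta : 0 < theta) :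
  (Pr [set w | (chi_stat mu La P (empirical xi w)
                  * \1_(Omega_m xi P La theta) w
                >= Num.sqrt (D%:R / n%:R)
                   + (1 + Num.sqrt (2 * theta) + theta / 6)
                     * Num.sqrt (2 * x / n%:R))%R]
    <= (expR (- x))%:E)%E
  /\
  ((1 - expR (- x))%:E <=
   Pr [set w | (chi_stat mu La P (empirical xi w)
                  * \1_(Omega_m xi P La theta) w
                < Num.sqrt (D%:R / n%:R) + Num.sqrt (2 * x / n%:R)
                  + 2 * Num.sqrt (theta / n%:R)
                    * Num.min (Num.sqrt x) ((x * D%:R / 2) `^ 4^-1)
                  + theta / 3 * Num.sqrt (x / n%:R)
                    * capped_sqrt_ratio x D)%R])%E.
Proof.
rewrite -/(sharp_threshold n D x theta); set z := sharp_threshold n D x theta.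
have z0 : 0 < z by exact: sharp_threshold_gt0.
pose p := cell_prob P La.
pose chi1 (v : {ffun 'I_n -> 'I_D.+1}) : R := chi p v * (dev_within p v theta)%:R.
have stat w : chi_stat mu La P (empirical xi w) * \1_(Omega_m xi P La theta) w
    = chi1 (labels xi hLa w).
  by rewrite (chi_statE xi hLa hP) (Omega_mE P xi hLa).
have tail : \sum_(v | z <= chi1 v) weight p v <= expR (- x).
  apply: le_trans (@chi_tail R 'I_n 'I_D.+1 p _ _ _ z theta x z0 htheta hx _).
  - rewrite [leLHS]big_mkcond [leRHS]big_mkcond; apply: ler_sum => v _.
    rewrite /chi1; case: (dev_within p v theta); rewrite ?mulr1 ?mulr0//=.
    by rewrite (lt_geF z0).
  - exact: cell_prob_gt0 hLa hP.
  - exact: sum_cell_prob hLa.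
  - by rewrite card_ord.
  - by rewrite !card_ord; exact: sharp_threshold_fixpoint.
have event S := labels_event hLa hxi S.
split.
  have := sharp_threshold_le n D hx htheta; rewrite -/z.
  set z1 := (X in _ <= X); rewrite -/z1 => zz1.
  rewrite (_ : [set w | _] = [set w | z1 <= chi1 (labels xi hLa w)]); last first.
    by apply/seteqP; split => w; rewrite /= stat.
  have [_ ->] := event (fun v => z1 <= chi1 v).
  rewrite lee_fin; apply: le_trans tail.
  rewrite [leLHS]big_mkcond [leRHS]big_mkcond; apply: ler_sum => v _.
  case: ifP => [z1v|_]; first by rewrite (le_trans zz1 z1v).
  by case: ifP => // _; apply: weight_ge0 => j; exact/ltW/(cell_prob_gt0 hLa hP).
have [mE PE] := event (fun v => z <= chi1 v).
rewrite (_ : [set w | _] = ~` [set w | z <= chi1 (labels xi hLa w)]); last first.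
  by apply/seteqP; split => w; rewrite /= stat ltNge => /negP.
by rewrite probability_setC// PE -EFinB lee_fin lerB.
Qed.
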